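(* Let $H$ be a hypergraph with all vertex and hyperedge weights equal to $1$ (every vertex in some hyperedge, every hyperedge with non-empty support). Let $(V^+\sqcup V^0\sqcup V^-,\,E^+\sqcup E^0\sqcup E^-)$ be its Dulmage–Mendelsohn decomposition and let $\{(V_{\alpha_r},E_{\alpha_r}):r=1,\dots,k\}$ be its spectral decomposition, with $(V_{\alpha_r},E_{\alpha_r})$ the factor of density $\alpha_r$. Then $$V^+=\bigcup_{\alpha_r>1}V_{\alpha_r},\quad V^0=V_1,\quad V^-=\bigcup_{\alpha_r<1}V_{\alpha_r},\qquad E^+=\bigcup_{\alpha_r>1}E_{\alpha_r},\quad E^0=E_1,\quad E^-=\bigcup_{\alpha_r<1}E_{\alpha_r},$$ where $V_1$, $E_1$ denote the factor of density exactly $1$ (empty if no factor has density $1$).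
   Context: A hypergraph $H=(V,E,\mathrm{supp})$ has finite vertex set $V$, finite hyperedge set $E$ and support map $\mathrm{supp}:E\to\mathcal P(V)$; here all weights are $1$, so $\mathrm{wt}$ of a set is its cardinality. A subgraph is a pair $(V',E')$, $V'\subset V$, $E'\subset E$, with $\mathrm{supp}(e)\subset V'$ for all $e\in E'$; its density is $|E'|/|V'|$. A quotient hypergraph is a pair $(V'',E'')$ such that every hyperedge whose support meets $V''$ lies in $E''$, with supports $\mathrm{supp}(e)\cap V''$. There is a unique subgraph of maximum density that is maximal under componentwise inclusion. The spectral decomposition of $H$ is the partition $V=V_{\alpha_1}\sqcup\dots\sqcup V_{\alpha_k}$, $E=E_{\alpha_1}\sqcup\dots\sqcup E_{\alpha_k}$ where inductively $(V_{\alpha_t},E_{\alpha_t})$ is the maximal subgraph of maximum density $\alpha_t$ in the quotient hypergraph $(V\setminus\bigcup_{r<t}V_{\alpha_r},E\setminus\bigcup_{r<t}E_{\alpha_r})$; then $\alpha_1>\dots>\alpha_k>0$. An exterior cover of $H$ is a pair $(\hat V,\hat E)$, $\hat V\subset V$, $\hat E\subset E$, such that for every $v\in V$, $e\in E$ with $v\in\mathrm{supp}(e)$, either $v\in\hat V$ or $e\in\hat E$; it is minimal if it minimizes $|\hat V|+|\hat E|$. With $\mathcal M$ the set of minimal exterior covers, the Dulmage–Mendelsohn decomposition is $V^+=\bigcap_{\mathcal M}\hat V$, $V^-=\bigcap_{\mathcal M}(V\setminus\hat V)$, $V^0=V\setminus(V^+\cup V^-)$, $E^+=\bigcap_{\mathcal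 M}(E\setminus\hat E)$, $E^-=\bigcap_{\mathcal M}\hat E$, $E^0=E\setminus(E^+\cup E^-)$. *)

(* Defs.v *)
From mathcomp Require Import all_boot all_order all_algebra.

Set Implicit Arguments.
Unset Strict Implicit.
Unset Printing Implicit Defensive.

Import Order.TTheory GRing.Theory Num.Theory.

Local Open Scope ring_scope.

(* The vertex and hyperedge sets are finite subsets of ambient finite types,
   so that a quotient of H lives over the same ambient types as H; the values
   of supp outside eset are irrelevant. *)
Record hypergraph (V E : finType) := Hypergraph {
  vset : {set V};
  eset : {set E};
  supp : E -> {set V};
  supp_sub : forall e, e \in eset -> supp e \subset vset
}.

Section Hypergraph.
Variables V E : finType.
Implicit Types (H : hypergraph V E) (U W : {set V}) (F X : {set E}).

Definition subgraph H W X : bool :=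
  [&& W \subset vset H, X \subset eset H
    & [forall e in X, supp H e \subset W]].

Definition density W X : rat := #|X|%:R / #|W|%:R.

Definition is_quotient H U F : bool :=
  [&& U \subset vset H, F \subset eset H
    & [forall e in eset H, (supp H e :&: U != set0) ==> (e \in F)]].

Lemma quotient_supp_sub H U F e : e \in F -> supp H e :&: U \subset U.
Proof. by move=> _; apply: subsetIr. Qed.

(* Only meaningful when is_quotient H U F holds. *)
Definition quotient H U F : hypergraph V E :=
  Hypergraph (@quotient_supp_sub H U F).

(* The density is only considered on subgraphs with a nonempty vertex set. *)
Definition densest H W X : Prop :=
  [/\ subgraph H W X, W != set0
    & forall W' X', subgraph H W' X' -> W' != set0 ->
        density W' X' <= density W X].

Definition max_densest H W X : Prop :=
  densest H W X /\
  forall W' X', densest H W' X' -> W \subset W' -> X \subset X' ->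
    W' = W /\ X' = X.

Definition vrest H k (VV : 'I_k -> {set V}) (t : nat) : {set V} :=
  vset H :\: \bigcup_(r < k | (r < t)%N) VV r.

Definition erest H k (EE : 'I_k -> {set E}) (t : nat) : {set E} :=
  eset H :\: \bigcup_(r < k | (r < t)%N) EE r.

(* Disjointness of the factors is implied by the first clause, since the t-th
   factor is contained in what remains after removing the previous ones. That
   clause also makes each remainder a quotient in the sense of is_quotient:
   see spectral_rest_quotient. *)
Definition spectral_decomposition H k
    (VV : 'I_k -> {set V}) (EE : 'I_k -> {set E}) : Prop :=
  [/\ forall t : 'I_k,
        max_densest (quotient H (vrest H VV t) (erest H EE t)) (VV t) (EE t),
      \bigcup_(r < k) VV r = vset H
    & \bigcup_(r < k) EE r = eset H].

(* The member of the family A at the index whose factor has density a, and the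
   empty set if there is no such index. *)
Definition factor_of_density (T : finType) k
    (VV : 'I_k -> {set V}) (EE : 'I_k -> {set E})
    (A : 'I_k -> {set T}) (a : rat) : {set T} :=
  if [pick r | density (VV r) (EE r) == a] is Some r then A r else set0.

Definition exterior_cover H W X : bool :=
  [&& W \subset vset H, X \subset eset H
    & [forall v in vset H, forall e in eset H,
        (v \in supp H e) ==> (v \in W) || (e \in X)]].

Definition min_covers H : {set {set V} * {set E}} :=
  [set C | exterior_cover H C.1 C.2 &
    [forall D : {set V} * {set E}, exterior_cover H D.1 D.2 ==>
      (#|C.1| + #|C.2| <= #|D.1| + #|D.2|)%N]].

Definition Vplus H : {set V} := \bigcap_(C in min_covers H) C.1.
Definition Vminus H : {set V} := \bigcap_(C in min_covers H) (vset H :\: C.1).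
Definition Vzero H : {set V} := vset H :\: (Vplus H :|: Vminus H).

Definition Eplus H : {set E} := \bigcap_(C in min_covers H) (eset H :\: C.2).
Definition Eminus H : {set E} := \bigcap_(C in min_covers H) C.2.
Definition Ezero H : {set E} := eset H :\: (Eplus H :|: Eminus H).

Lemma spectral_rest_quotient H k
    (VV : 'I_k -> {set V}) (EE : 'I_k -> {set E}) (t : nat) :
  spectral_decomposition H VV EE ->
  is_quotient H (vrest H VV t) (erest H EE t).
Proof.
case=> dec _ _; apply/and3P; split; try exact: subsetDl.
apply/forall_inP=> e eH; apply/implyP=> /set0Pn[v].
rewrite !inE eH andbT => /and3P[ve /negP vN vH].
apply/negP=> /bigcupP[r rt er]; apply: vN.
have [[/and3P[_ _ /forall_inP/(_ e er) /= sub] _ _] _] := dec r.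
case vr: (v \in vrest H VV r).
  by apply/bigcupP; exists r => //; apply: (subsetP sub); rewrite inE ve.
move: vr; rewrite inE vH andbT => /negbFE/bigcupP[s sr vs].
by apply/bigcupP; exists s => //; apply: ltn_trans rt.
Qed.

Lemma max_densest_exists H :
  vset H != set0 -> exists C, max_densest H C.1 C.2.
Proof.
move=> H0.
pose P (C : {set V} * {set E}) := subgraph H C.1 C.2 && (C.1 != set0).
have P0 : P (vset H, eset H).
  rewrite /P H0 andbT /subgraph /= !subxx /=.
  by apply/forall_inP=> e /supp_sub.
case: (Order.TotalTheory.arg_maxP (fun C => density C.1 C.2) P0).
move=> C /andP[sC C0] maxC.
have dC : densest H C.1 C.2.
  by split=> // W' X' s' n'; apply: (maxC (W', X')); rewrite /P /= s' n'.
pose Q D := P D && (density C.1 C.2 <= density D.1 D.2).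
have QC : Q C by rewrite /Q /P sC C0 /=.
case: (arg_maxnP (fun D : {set V} * {set E} => #|D.1| + #|D.2|)%N QC).
move=> D /andP[/andP[sD D0] CD] maxD; exists D; split.
  split=> // W' X' s' n'; apply: le_trans CD.
  by apply: (maxC (W', X')); rewrite /P /= s' n'.
move=> W' X' [s' n' d'] sW sX.
have /maxD /= : Q (W', X') by rewrite /Q /P /= s' n' d'.
have lW := subset_leq_card sW; have lX := subset_leq_card sX => le.
split; apply/esym/eqP; rewrite eqEcard ?sW ?sX /=.
  by rewrite -(leq_add2r #|X'|) (leq_trans le) // leq_add2l.
by rewrite -(leq_add2l #|W'|) (leq_trans le) // leq_add2r.
Qed.

Lemma densest_full H W X :
  densest H W X -> vset H \subset W -> eset H \subset X.
Proof.
case=> /and3P[sW sX _] W0 dmax HW; apply/subsetP=> e eH.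
have sub : subgraph H W (eset H).
  rewrite /subgraph sW subxx; apply/forall_inP=> f /supp_sub sf.
  exact: subset_trans HW.
have := dmax _ _ sub W0; rewrite ler_pM2r; last first.
  by rewrite invr_gt0 ltr0n card_gt0.
rewrite ler_nat => le.
by have /eqP-> : X == eset H by rewrite eqEcard sX.
Qed.

Lemma spectral_decomposition_exists H :
  (forall e, e \in eset H -> supp H e != set0) ->
  exists (k : nat) (VV : 'I_k -> {set V}) (EE : 'I_k -> {set E}),
    spectral_decomposition H VV EE.
Proof.
move=> ne.
have [g gP] : exists g : {set V} * {set E} -> {set V} * {set E},
    forall S, S.1 != set0 -> max_densest (quotient H S.1 S.2) (g S).1 (g S).2.
  apply: (fin_all_exists (P := fun (S C : {set V} * {set E}) => S.1 != set0 ->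
    max_densest (quotient H S.1 S.2) C.1 C.2)) => S.
  have [->|S0] := eqVneq S.1 set0; first by exists S.
  by have [C] := @max_densest_exists (quotient H S.1 S.2) S0; exists C.
pose st n := iter n (fun S => (S.1 :\: (g S).1, S.2 :\: (g S).2))
  (vset H, eset H).
have stop : exists n, (st n).1 == set0.
  suff dec n : (st n).1 == set0 \/ (#|(st n).1| + n <= #|vset H|)%N.
    have [//|le] := dec #|vset H|.+1; first by exists #|vset H|.+1.
    by move: le; rewrite addnS ltnNge leq_addl.
  elim: n => [|n IHn]; first by right; rewrite addn0.
  have [s0|s0] := eqVneq (st n).1 set0.
    by left; rewrite /= -/(st n) s0 set0D.
  case: IHn => [/idPn//|le]; right.
  have [[/and3P[sub _ _] ne0 _] _] := gP _ s0.
  rewrite /= -/(st n) addnS -addSn (leq_trans _ le) // leq_add2r.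
  apply: proper_card; rewrite properE subsetDl.
  apply: contraNN ne0 => /subsetP sD; apply/eqP/setP=> v; rewrite inE.
  apply/negP=> vg; have := sD v (subsetP sub v vg).
  by rewrite inE vg.
case: (ex_minnP stop) => k /eqP k0 kmin.
have ltk n : (n < k)%N -> (st n).1 != set0.
  by move=> lt; apply/negP=> /kmin; rewrite leqNgt lt.
pose VV (r : 'I_k) := (g (st r)).1; pose EE (r : 'I_k) := (g (st r)).2.
have rest (T : finType) (A : {set T}) (B : 'I_k -> {set T}) t (lt : (t < k)%N) :
    A :\: \bigcup_(r < k | (r < t.+1)%N) B r =
    (A :\: \bigcup_(r < k | (r < t)%N) B r) :\: B (Ordinal lt).
  rewrite (bigD1 (Ordinal lt)) //= setUC -setDDl; congr (_ :\: _ :\: _).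
  by apply: eq_bigl => r; rewrite ltnS [RHS]ltn_neqAle andbC.
have stE t : (t <= k)%N -> (vrest H VV t, erest H EE t) = st t.
  elim: t => [_|t IHt lt]; first by rewrite /vrest /erest !big_pred0 ?setD0.
  by rewrite /vrest /erest !rest /= -/(st t) -(IHt (ltnW lt)) /VV /EE /=
    -(IHt (ltnW lt)).
have fin : st k = (set0, set0).
  case: (posnP k) => [k00|kpos].
    move: k0; rewrite k00 /= => vH0; rewrite vH0; congr (_, _).
    apply/setP=> e; rewrite inE; apply/negP=> eH; have := ne e eH.
    by have := supp_sub eH; rewrite vH0 subset0 => ->.
  have lt : (k.-1 < k)%N by rewrite prednK.
  have ek : st k = ((st k.-1).1 :\: (g (st k.-1)).1,
                    (st k.-1).2 :\: (g (st k.-1)).2) by rewrite -{1}(prednK kpos).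
  have /eqP := k0; rewrite {1}ek setD_eq0 => full.
  have [dg _] := gP _ (ltk _ lt); have /= := densest_full dg full.
  by rewrite -setD_eq0 [LHS]surjective_pairing k0 ek /= => /eqP->.
have [vk ek] : vrest H VV k = set0 /\ erest H EE k = set0.
  by move: (stE k (leqnn k)); rewrite fin => -[-> ->].
have dec (t : 'I_k) :
    max_densest (quotient H (vrest H VV t) (erest H EE t)) (VV t) (EE t).
  have := gP (st t) (ltk t (ltn_ord t)).
  by rewrite -{1 2}(stE t (ltnW (ltn_ord t))).
exists k, VV, EE; split=> //.
  apply/eqP; rewrite eqEsubset -[X in _ && X]setD_eq0; apply/andP; split.
    apply/bigcupsP=> r _; have [[/and3P[sub _ _] _ _] _] := dec r.
    exact: subset_trans sub (subsetDl _ _).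
  by move/eqP: vk; rewrite /vrest; under eq_bigl do rewrite ltn_ord.
apply/eqP; rewrite eqEsubset -[X in _ && X]setD_eq0; apply/andP; split.
  apply/bigcupsP=> r _; have [[/and3P[_ sub _] _ _] _] := dec r.
  exact: subset_trans sub (subsetDl _ _).
by move/eqP: ek; rewrite /erest; under eq_bigl do rewrite ltn_ord.
Qed.

End Hypergraph.

(* Main.v *)
(* Complementing the edge part turns an exterior cover (W, X) into a subgraph
   (W, E \ X), and the minimal covers into the subgraphs maximizing the excess
   |F| - |W|. Each factor is densest in its quotient, so a subgraph (W, F)
   satisfies |F /\ E_r| <= alpha_r |W /\ V_r| for every r; summing over r, a
   subgraph of maximal excess contains every factor of density > 1, avoids every
   factor of density < 1 and is unconstrained by the factor of density 1. As the
   densities decrease, the unions of the factors of density > 1 and of those of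
   density >= 1 are themselves subgraphs, so both extremes are attained. *)
Require Import Defs.
From mathcomp Require Import all_boot all_order all_algebra.

Set Implicit Arguments.
Unset Strict Implicit.
Unset Printing Implicit Defensive.

Import Order.TTheory GRing.Theory Num.Theory.

Local Open Scope ring_scope.

(** * Finite families that partition a set *)

Section Partition.
Variables (T : finType) (k : nat) (A : 'I_k -> {set T}) (S : {set T}).
Hypothesis disjA : forall i j, i != j -> [disjoint A i & A j].
Hypothesis coverA : \bigcup_(r < k) A r = S.

Lemma in_bigcup_part (P : pred 'I_k) r x :
  x \in A r -> (x \in \bigcup_(i < k | P i) A i) = P r.
Proof.
move=> xr; apply/bigcupP/idP => [[i Pi xi]|Pr]; last by exists r.
have [<- //|ir] := eqVneq i r.
by move: (disjointFr (disjA ir) xi); rewrite xr.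
Qed.

Lemma part_mem x : x \in S -> exists r, x \in A r.
Proof. by rewrite -coverA => /bigcupP[r _ xr]; exists r. Qed.

Lemma part_sub r : A r \subset S.
Proof. by rewrite -coverA (bigcup_max r). Qed.

Lemma bigcup_part_sub (P : pred 'I_k) : \bigcup_(i < k | P i) A i \subset S.
Proof. by apply/bigcupsP=> r _; apply: part_sub. Qed.

Lemma card_part (W : {set T}) : W \subset S -> #|W| = (\sum_(r < k) #|W :&: A r|)%N.
Proof.
move=> sWS; have {1}-> : W = \bigcup_(r < k) (W :&: A r).
  by rewrite -big_distrr /= coverA; apply/esym/setIidPl.
rewrite -sum1_card partition_disjoint_bigcup => [|i j ij].
  by apply: eq_bigr => r _; rewrite sum1_card.
by apply: disjointWl (subsetIr _ _) _; apply: disjointWr (subsetIr _ _) (disjA ij).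
Qed.

Lemma bigcup_partI (P : pred 'I_k) r :
  (\bigcup_(i < k | P i) A i) :&: A r = if P r then A r else set0.
Proof.
apply/setP=> x; rewrite inE; case xr: (x \in A r).
  by rewrite (in_bigcup_part _ xr); case: (P r); rewrite ?xr ?inE.
by rewrite andbF; case: (P r); rewrite ?xr ?inE.
Qed.

Lemma bigcup_part_complement (P : pred 'I_k) :
  S :\: \bigcup_(i < k | P i) A i = \bigcup_(i < k | ~~ P i) A i.
Proof.
apply/setP=> x; rewrite inE; case xS: (x \in S).
  have [r xr] := part_mem xS; by rewrite !(in_bigcup_part _ xr) andbT.
rewrite andbF; apply/esym/negbTE; apply: contraFN xS.
exact/subsetP/bigcup_part_sub.
Qed.

Lemma bigcup_partU_complement (P Q : pred 'I_k) :
  S :\: (\bigcup_(i < k | P i) A i :|: \bigcup_(i < k | Q i) A i) =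
  \bigcup_(i < k | ~~ (P i || Q i)) A i.
Proof.
rewrite -bigcup_part_complement; congr (_ :\: _); apply/setP=> x; rewrite inE.
apply/orP/bigcupP => [[]/bigcupP[i Pi xi]|[i /orP[]Pi xi]].
- by exists i; rewrite ?Pi.
- by exists i; rewrite ?Pi ?orbT.
- by left; apply/bigcupP; exists i.
- by right; apply/bigcupP; exists i.
Qed.

End Partition.

Lemma bigcap_attained (I T : finType) (M : {set I}) (F : I -> {set T}) i :
  i \in M -> (forall j, j \in M -> F i \subset F j) ->
  \bigcap_(j in M) F j = F i.
Proof.
move=> iM le; apply/eqP; rewrite eqEsubset (bigcap_inf i) //.
exact/bigcapsP.
Qed.

Section FactorOfDensity.
Variables (V E T : finType) (k : nat).
Variables (VV : 'I_k -> {set V}) (EE : 'I_k -> {set E}).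
Hypothesis inj_density : injective (fun r => density (VV r) (EE r)).

(** Distinct factors have distinct densities, so the union has at most one term and the index chosen
    by [pick] is the only candidate. *)
Lemma factor_of_densityE (A : 'I_k -> {set T}) a :
  factor_of_density VV EE A a = \bigcup_(r < k | density (VV r) (EE r) == a) A r.
Proof.
rewrite /factor_of_density; case: pickP => [r /eqP rE|none].
  rewrite (big_pred1 r) // => i /=; rewrite -rE.
  by apply/eqP/eqP => [/inj_density|->].
by rewrite big_pred0.
Qed.

End FactorOfDensity.

(** * Exterior covers as complements of subgraphs *)

Section Covers.
Variables V E : finType.
Implicit Types (H : hypergraph V E) (W : {set V}) (X : {set E}).

(** Rational because it may be negative, where subtraction in [nat] would truncate, and because it
    is bounded by means of densities. *)
Definition excess W X : rat := #|X|%:R - #|W|%:R.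

Lemma subgraphP H W X :
  reflect [/\ W \subset vset H, X \subset eset H
    & forall e, e \in X -> supp H e \subset W] (subgraph H W X).
Proof.
apply: (iffP and3P) => [[sW sX /forall_inP sup]|[sW sX sup]]; split=> //.
exact/forall_inP.
Qed.

Lemma exterior_coverE H W X :
  exterior_cover H W X = (X \subset eset H) && subgraph H W (eset H :\: X).
Proof.
rewrite /exterior_cover /subgraph subsetDl /= andbCA; congr (_ && (_ && _)).
apply/forall_inP/forall_inP => [cov e|sub v vH].
  rewrite inE => /andP[eX eH]; apply/subsetP=> v ve.
  have /cov/forall_inP/(_ e eH) : v \in vset H.
    exact: subsetP (supp_sub eH) v ve.
  by rewrite ve (negbTE eX) orbF.
apply/forall_inP=> e eH; apply/implyP=> ve.
case eX: (e \in X); rewrite ?orbT // orbF.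
by apply: (subsetP (sub e _)) => //; rewrite inE eX.
Qed.

Lemma card_coverE H W X : X \subset eset H ->
  (#|W| + #|X|)%:R = #|eset H|%:R - excess W (eset H :\: X).
Proof.
move=> sX; have -> : #|X| = (#|eset H| - #|eset H :\: X|)%N.
  by rewrite -(cardsID X (eset H)) (setIidPr sX) addnK.
rewrite /excess natrD natrB ?subset_leq_card ?subsetDl //.
by rewrite opprB addrA addrAC addrA [_ + #|eset H|%:R]addrC addrA.
Qed.

Lemma min_coversP H (C : {set V} * {set E}) :
  reflect [/\ C.2 \subset eset H, subgraph H C.1 (eset H :\: C.2)
    & forall W X, subgraph H W X ->
        excess W X <= excess C.1 (eset H :\: C.2)]
  (C \in min_covers H).
Proof.
rewrite inE exterior_coverE.
apply: (iffP andP) => [[/andP[sC subC] /forallP minC]|[sC subC maxC]]; split=> //.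
- move=> W X subWX; have [_ sX _] := subgraphP _ _ _ subWX.
  have XK : eset H :\: (eset H :\: X) = X by rewrite setDDr setDv set0U; apply/setIidPr.
  have := minC (W, eset H :\: X); rewrite /= exterior_coverE subsetDl XK subWX /=.
  by rewrite -(ler_nat rat) !(@card_coverE H) ?subsetDl // XK lerD2l lerN2.
- by rewrite sC.
apply/forallP=> D; apply/implyP; rewrite exterior_coverE => /andP[sD subD].
by rewrite -(ler_nat rat) !(@card_coverE H) // lerD2l lerN2 maxC.
Qed.

End Covers.

Lemma disjoint_of_rests (T : finType) k (A : 'I_k -> {set T}) (S : {set T}) :
  (forall t : 'I_k, A t \subset S :\: \bigcup_(r < k | (r < t)%N) A r) ->
  forall i j, i != j -> [disjoint A i & A j].
Proof.
move=> sub i j; wlog lt_ij : i j / (i < j)%N => [hw ij|_].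
  have := ij; rewrite -val_eqE neq_ltn => /orP[]; first by move/hw; apply.
  by rewrite disjoint_sym => /hw; apply; rewrite eq_sym.
rewrite disjoint_sym; apply: disjointWl (sub j) _.
rewrite setDE disjoint_sym disjoints_subset setCI setCK.
by rewrite subsetU // (bigcup_max i) ?orbT.
Qed.

(** * Structure of the spectral decomposition *)

Section Spectral.
Variables (V E : finType) (H : hypergraph V E) (k : nat).
Variables (VV : 'I_k -> {set V}) (EE : 'I_k -> {set E}).
Implicit Types (r s t : 'I_k) (W : {set V}) (X : {set E}).
Hypothesis supp_neq0 : forall e, e \in eset H -> supp H e != set0.
Hypothesis spectral : spectral_decomposition H VV EE.

Local Notation d r := (density (VV r) (EE r)).
Local Notation quot t := (quotient H (vrest H VV t) (erest H EE t)).

Lemma factor_subgraph t : subgraph (quot t) (VV t) (EE t).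
Proof. by case: spectral => /(_ t) [[]]. Qed.

Lemma VV_neq0 t : VV t != set0.
Proof. by case: spectral => /(_ t) [[]]. Qed.

Lemma density_max t W X :
  subgraph (quot t) W X -> W != set0 -> density W X <= d t.
Proof. by case: spectral => /(_ t) [[_ _ +] _] _ _; apply. Qed.

(** A subgraph at least as dense as the densest one is itself densest, so the inclusion-maximality
    of the factor applies to it. *)
Lemma factor_max t W X : subgraph (quot t) W X ->
  VV t \subset W -> EE t \subset X -> d t <= density W X ->
  W = VV t /\ X = EE t.
Proof.
move=> subWX sW sX le; case: spectral => /(_ t) [_ maxt] _ _.
apply: maxt => //; split=> // [|W' X' sub' n0].
  by apply: contraNneq (VV_neq0 t) => W0; rewrite -subset0 -W0.
exact: le_trans (density_max sub' n0) le.
Qed.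

Lemma VV_disjoint i j : i != j -> [disjoint VV i & VV j].
Proof.
by apply: (disjoint_of_rests (S := vset H)) => t; case/subgraphP: (factor_subgraph t).
Qed.

Lemma EE_disjoint i j : i != j -> [disjoint EE i & EE j].
Proof.
by apply: (disjoint_of_rests (S := eset H)) => t; case/subgraphP: (factor_subgraph t).
Qed.

Lemma VV_cover : \bigcup_(r < k) VV r = vset H. Proof. by case: spectral. Qed.
Lemma EE_cover : \bigcup_(r < k) EE r = eset H. Proof. by case: spectral. Qed.

Lemma mem_vrest t r v : v \in VV r -> (v \in vrest H VV t) = (t <= r)%N.
Proof.
move=> vr; rewrite inE (in_bigcup_part VV_disjoint _ vr) -leqNgt.
by rewrite (subsetP (part_sub VV_cover r)) ?andbT.
Qed.

Lemma mem_erest t r e : e \in EE r -> (e \in erest H EE t) = (t <= r)%N.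
Proof.
move=> er; rewrite inE (in_bigcup_part EE_disjoint _ er) -leqNgt.
by rewrite (subsetP (part_sub EE_cover r)) ?andbT.
Qed.

(** If [v] belonged to a factor later than [r], it would still be present in the quotient at stage
    [r]; the support of [e] there lies in [VV r], which is disjoint from [VV s]. *)
Lemma supp_factor_le r s e v :
  e \in EE r -> v \in supp H e -> v \in VV s -> (s <= r)%N.
Proof.
move=> er ve vs; rewrite leqNgt; apply/negP=> lt.
have [_ _ /(_ e er)/subsetP/(_ v)] := subgraphP _ _ _ (factor_subgraph r).
rewrite inE ve (mem_vrest _ vs) ltnW // => /(_ isT) vr.
have sr : s != r by rewrite -val_eqE gtn_eqF.
by rewrite (disjointFr (VV_disjoint sr) vs) in vr.
Qed.

Lemma card_EE t : #|EE t|%:R = d t * #|VV t|%:R.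
Proof. by rewrite divfK // pnatr_eq0 cards_eq0 VV_neq0. Qed.

(* If the last factor met by supp e came before the one containing e, adding e
   to that earlier factor would raise its density. *)
Lemma supp_meets_factor r e : e \in EE r -> supp H e :&: VV r != set0.
Proof.
move=> er; have eH := subsetP (part_sub EE_cover r) e er.
have /set0Pn[v ve] := supp_neq0 eH.
have [s0 vs0] := part_mem VV_cover (subsetP (supp_sub eH) v ve).
have P0 : supp H e :&: VV s0 != set0 by apply/set0Pn; exists v; rewrite inE ve.
pose P s := supp H e :&: VV s != set0.
case: (@arg_maxnP _ s0 P (fun s => s) P0) => s sP smax.
have [sr|sr] := eqVneq s r; first by rewrite -sr.
have lt : (s < r)%N.
  have /set0Pn[w] := sP; rewrite inE => /andP[we ws].
  by rewrite ltn_neqAle val_eqE sr (supp_factor_le er we ws).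
have [sVs sEs supps] := subgraphP _ _ _ (factor_subgraph s).
have subs : subgraph (quot s) (VV s) (e |: EE s).
  apply/subgraphP; split=> //= [|f].
    by rewrite subUset sub1set (mem_erest _ er) ltnW.
  case/setU1P=> [->|/supps//]; apply/subsetP=> w; rewrite inE => /andP[we ws].
  have [q wq] := part_mem VV_cover (subsetP (supp_sub eH) w we).
  have le1 : (q <= s)%N by apply: smax; apply/set0Pn; exists w; rewrite inE we.
  have le2 : (s <= q)%N by rewrite -(mem_vrest s wq).
  by have <- : q = s by apply/val_inj/anti_leq; rewrite le1.
have [_ /setP/(_ e)] : VV s = VV s /\ e |: EE s = EE s.
  apply: factor_max => //; first exact: subsetUr.
  rewrite /density ler_pM2r ?invr_gt0 ?ltr0n ?card_gt0 ?VV_neq0 //.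
  by rewrite ler_nat subset_leq_card // subsetUr.
by rewrite setU11 => /esym es; rewrite (disjointFr (EE_disjoint sr) es) in er.
Qed.

(** The trace of a subgraph of [H] on the factor [t] is a subgraph of the quotient in which that
    factor is densest. *)
Lemma card_factor_le W X t : subgraph H W X ->
  #|X :&: EE t|%:R <= d t * #|W :&: VV t|%:R.
Proof.
case/subgraphP=> sW sX supX.
(* Densities are compared only on nonempty vertex sets. If the trace has no vertex, it has no
   hyperedge either, since each hyperedge of [EE t] has a support meeting [VV t]. *)
have [W0|W0] := eqVneq (W :&: VV t) set0.
  suff -> : X :&: EE t = set0 by rewrite W0 !cards0 mulr0.
  apply/eqP; rewrite -subset0; apply/subsetP=> e; rewrite inE => /andP[eX et].
  have /set0Pn[v] := supp_meets_factor et.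
  by move=> /(subsetP (setSI _ (supX e eX))); rewrite W0 inE.
rewrite -ler_pdivrMr ?ltr0n ?card_gt0 //; apply: density_max => //.
have [sVt sEt supt] := subgraphP _ _ _ (factor_subgraph t).
apply/subgraphP; split=> [||e] /=.
- exact: subset_trans (subsetIr _ _) sVt.
- exact: subset_trans (subsetIr _ _) sEt.
rewrite inE => /andP[eX et]; rewrite subsetI supt // andbT.
by rewrite (subset_trans (subsetIl _ _)) ?supX.
Qed.

(** Two consecutive factors together form a subgraph of the quotient at stage [s]. Its density is a
    mediant of [d s] and [d t], so [d s <= d t] would make it at least [d s], against the maximality
    of the factor [s]. *)
Lemma density_succ (s t : 'I_k) : t = s.+1 :> nat -> d t < d s.
Proof.
move=> ts; have st : s != t by rewrite -val_eqE /= ts ltn_eqF.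
rewrite ltNge; apply/negP=> le.
have [sVs sEs sups] := subgraphP _ _ _ (factor_subgraph s).
have [sVt sEt supt] := subgraphP _ _ _ (factor_subgraph t).
have cU (T : finType) (A B : {set T}) :
    [disjoint A & B] -> #|A :|: B| = (#|A| + #|B|)%N.
  by rewrite cardsU -setI_eq0 => /eqP->; rewrite cards0 subn0.
have [eqV _] : VV s :|: VV t = VV s /\ EE s :|: EE t = EE s.
  apply: factor_max; rewrite ?subsetUl //.
    apply/subgraphP; split=> /= [||e].
    - rewrite subUset sVs; apply/subsetP=> v vt.
      by rewrite (mem_vrest _ vt) ts.
    - rewrite subUset sEs; apply/subsetP=> e et.
      by rewrite (mem_erest _ et) ts.
    case/setUP=> [es|et]; first exact: subset_trans (sups e es) (subsetUl _ _).
    (* The index [r] of the factor of [v] satisfies [s <= r], as [v] survives at stage [s], and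
       [r <= t], by [supp_factor_le]; since [t] is [s.+1], it is [s] or [t]. *)
    apply/subsetP=> v; rewrite inE => /andP[ve vs].
    have eH := subsetP (part_sub EE_cover t) e et.
    have [r vr] := part_mem VV_cover (subsetP (supp_sub eH) v ve).
    have := supp_factor_le et ve vr; move: vs; rewrite (mem_vrest _ vr) inE.
    rewrite ts leq_eqVlt val_eqE => /orP[/eqP->|lt le']; first by rewrite vr.
    suff <- : r = t by rewrite vr orbT.
    by apply/val_inj/anti_leq; rewrite /= ts le' lt.
  rewrite {2}/density (cU _ _ _ (VV_disjoint st)) (cU _ _ _ (EE_disjoint st)).
  rewrite ler_pdivlMr; last by rewrite ltr0n ltn_addr // card_gt0 VV_neq0.
  by rewrite !natrD mulrDr !card_EE lerD2l ler_wpM2r.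
have /set0Pn[v vt] := VV_neq0 t.
have : v \in VV s by rewrite -eqV inE vt orbT.
by move=> vs; rewrite (disjointFr (VV_disjoint st) vs) in vt.
Qed.

Lemma density_decreasing (s t : 'I_k) : (s < t)%N -> d t < d s.
Proof.
have [n] := ubnP (t : nat); elim: n t => // n IHn t tn st.
have pt : t.-1.+1 = t by rewrite prednK // (leq_ltn_trans _ st).
have pk : (t.-1 < k)%N by rewrite pt ltnW.
have step : d t < d (Ordinal pk) by apply: density_succ; rewrite pt.
move: st; rewrite -{1}pt ltnS leq_eqVlt => /orP[/eqP sp|sp].
  by have -> : s = Ordinal pk by apply: val_inj.
by apply: lt_trans step _; apply: IHn => //=; rewrite pt -ltnS.
Qed.

Lemma density_inj : injective (fun r => d r).
Proof.
move=> s t eqd; apply: val_inj; case: (ltngtP s t) => // /density_decreasing.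
  by rewrite eqd ltxx.
by rewrite eqd ltxx.
Qed.

Lemma density_le (s t : 'I_k) : (s <= t)%N -> d t <= d s.
Proof.
by rewrite leq_eqVlt => /orP[/eqP/val_inj->//|/density_decreasing/ltW].
Qed.

(** The support of a hyperedge only meets factors with index at most its own, so a downward closed
    set of indices captures it entirely. *)
Lemma prefix_subgraph (P : pred 'I_k) :
  (forall s t : 'I_k, (s <= t)%N -> P t -> P s) ->
  subgraph H (\bigcup_(r < k | P r) VV r) (\bigcup_(r < k | P r) EE r).
Proof.
move=> downP; apply/subgraphP; split.
- exact: bigcup_part_sub VV_cover P.
- exact: bigcup_part_sub EE_cover P.
move=> e /bigcupP[r Pr er]; apply/subsetP=> v ve.
have eH := subsetP (part_sub EE_cover r) e er.
have [s vs] := part_mem VV_cover (subsetP (supp_sub eH) v ve).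
apply/bigcupP; exists s => //; apply: downP Pr.
exact: supp_factor_le er ve vs.
Qed.

(** * Bounding the excess factor by factor *)

Lemma excess_sum W X : W \subset vset H -> X \subset eset H ->
  excess W X = \sum_(r < k) excess (W :&: VV r) (X :&: EE r).
Proof.
move=> sW sX; rewrite /excess (card_part VV_disjoint VV_cover sW).
by rewrite (card_part EE_disjoint EE_cover sX) !natr_sum -sumrB.
Qed.

(** The maximum of [(d r - 1) * x] over [x] between 0 and [#|VV r|], reached at one end or the other
    according to the sign of [d r - 1]. *)
Definition max_excess r : rat := if 1 < d r then excess (VV r) (EE r) else 0.

Lemma excess_factor_le W X r : subgraph H W X ->
  excess (W :&: VV r) (X :&: EE r) <= max_excess r.
Proof.
move=> sub; apply: (@le_trans _ _ ((d r - 1) * #|W :&: VV r|%:R)).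
  by rewrite /excess mulrBl mul1r lerD2r card_factor_le.
rewrite /max_excess; case: ltP => [gt1|le1].
  have -> : excess (VV r) (EE r) = (d r - 1) * #|VV r|%:R.
    by rewrite /excess card_EE mulrBl mul1r.
  apply: ler_wpM2l; first by rewrite subr_ge0 ltW.
  by rewrite ler_nat subset_leq_card ?subsetIr.
by rewrite mulr_le0_ge0 // subr_le0.
Qed.

(** Equality gives [(d r - 1) * #|VV r| <= (d r - 1) * #|W :&: VV r|] with a positive coefficient,
    so [W] contains all of [VV r]; the hyperedge counts must then agree too. *)
Lemma excess_factor_gt1 W X r : subgraph H W X -> 1 < d r ->
  excess (W :&: VV r) (X :&: EE r) = max_excess r ->
  VV r \subset W /\ EE r \subset X.
Proof.
move=> sub gt1; rewrite /max_excess gt1 /excess => eqx.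
have le := card_factor_le r sub.
have full : #|VV r|%:R <= #|W :&: VV r|%:R :> rat.
  rewrite -(ler_pM2l (x := d r - 1)) ?subr_gt0 //.
  by rewrite !mulrBl !mul1r -card_EE -eqx lerD2r.
have sV : VV r \subset W.
  apply/setIidPr/eqP; rewrite eqEcard subsetIr.
  by rewrite -(ler_nat rat).
split=> //; move: eqx; rewrite (setIidPr sV) => /addIr /eqP.
rewrite eqr_nat => /eqP eqE; apply/setIidPr/eqP.
by rewrite eqEcard subsetIr eqE /=.
Qed.

(** Zero excess gives [#|W :&: VV r| = #|X :&: EE r| <= d r * #|W :&: VV r|], which for [d r < 1]
    leaves only the empty trace. *)
Lemma excess_factor_lt1 W X r : subgraph H W X -> d r < 1 ->
  excess (W :&: VV r) (X :&: EE r) = max_excess r ->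
  W :&: VV r = set0 /\ X :&: EE r = set0.
Proof.
move=> sub lt1; rewrite /max_excess ltNge (ltW lt1) /= /excess => eqx.
have le := card_factor_le r sub.
have W0 : #|W :&: VV r| = 0%N.
  apply/eqP; rewrite -leqn0 -(ler_nat rat) -(ler_pM2l (x := 1 - d r)) ?subr_gt0 //.
  rewrite mulr0 mulrBl mul1r subr_le0 (le_trans _ le) //.
  by rewrite -subr_ge0 eqx.
split; apply/eqP; rewrite -cards_eq0 ?W0 //.
by move/eqP: eqx; rewrite W0 subr0 pnatr_eq0.
Qed.

Lemma excess_le W X : subgraph H W X -> excess W X <= \sum_r max_excess r.
Proof.
move=> sub; have [sW sX _] := subgraphP _ _ _ sub.
by rewrite excess_sum // ler_sum // => r _; apply: excess_factor_le.
Qed.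

(** The gaps between the bounds and the contributions are nonnegative with sum zero, so each
    vanishes. *)
Lemma excess_eq W X r : subgraph H W X -> excess W X = \sum_r max_excess r ->
  excess (W :&: VV r) (X :&: EE r) = max_excess r.
Proof.
move=> sub; have [sW sX _] := subgraphP _ _ _ sub; rewrite excess_sum // => eqs.
have ge0 i : true -> 0 <= max_excess i - excess (W :&: VV i) (X :&: EE i).
  by rewrite subr_ge0 excess_factor_le.
have /eqP : \sum_i (max_excess i - excess (W :&: VV i) (X :&: EE i)) = 0.
  by rewrite sumrB eqs subrr.
by rewrite psumr_eq0 // => /allP/(_ r (mem_index_enum _))/=; rewrite subr_eq0 => /eqP.
Qed.

(** A factor of density 1 has excess zero, so including or omitting it does not change the total. *)
Lemma excess_prefix (P : pred 'I_k) :
  (forall r, 1 < d r -> P r) -> (forall r, P r -> 1 <= d r) ->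
  excess (\bigcup_(r < k | P r) VV r) (\bigcup_(r < k | P r) EE r) =
  \sum_r max_excess r.
Proof.
move=> gtP Pge; rewrite excess_sum ?(bigcup_part_sub VV_cover, bigcup_part_sub EE_cover) //.
apply: eq_bigr => r _; rewrite (bigcup_partI VV_disjoint) (bigcup_partI EE_disjoint).
rewrite /max_excess; case: ifP => [/Pge|nP].
  rewrite le_eqVlt => /orP[/eqP d1|->//]; rewrite -d1 ltxx.
  by rewrite /excess card_EE -d1 mul1r subrr.
case: ifP => [/gtP|_]; first by rewrite nP.
by rewrite /excess !cards0 subrr.
Qed.

(** * Minimal covers and the two extreme ones *)

Lemma prefix_cover (P : pred 'I_k) :
  (forall s t : 'I_k, (s <= t)%N -> P t -> P s) ->
  (forall r, 1 < d r -> P r) -> (forall r, P r -> 1 <= d r) ->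
  (\bigcup_(r < k | P r) VV r, \bigcup_(r < k | ~~ P r) EE r) \in min_covers H.
Proof.
move=> downP gtP Pge; apply/min_coversP => /=.
have sE := bigcup_part_sub EE_cover.
have -> : eset H :\: \bigcup_(r < k | ~~ P r) EE r = \bigcup_(r < k | P r) EE r.
  rewrite (bigcup_part_complement EE_disjoint EE_cover).
  by apply: eq_bigl => r; rewrite negbK.
split; [exact: sE | exact: prefix_subgraph |].
by move=> W X sub; rewrite excess_prefix // excess_le.
Qed.

(** The factors of density above 1 form a subgraph attaining the upper bound of [excess_le], so the
    subgraph of any minimal cover attains it too, and equality holds in every factor. *)
Lemma min_cover_factor C r : C \in min_covers H ->
  excess (C.1 :&: VV r) ((eset H :\: C.2) :&: EE r) = max_excess r.
Proof.
case/min_coversP=> sC sub maxC; apply: excess_eq => //.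
apply/le_anti; rewrite excess_le //=.
rewrite -(@excess_prefix (fun r => 1 < d r)) => // [|q /ltW//].
apply: maxC; apply: prefix_subgraph => s t st gt1.
exact: lt_le_trans gt1 (density_le st).
Qed.

Lemma min_cover_gt1 C r : C \in min_covers H -> 1 < d r ->
  VV r \subset C.1 /\ EE r \subset eset H :\: C.2.
Proof.
move=> MC gt1; have [_ sub _] := min_coversP _ _ MC.
exact: excess_factor_gt1 sub gt1 (min_cover_factor r MC).
Qed.

Lemma min_cover_lt1 C r : C \in min_covers H -> d r < 1 ->
  VV r \subset vset H :\: C.1 /\ EE r \subset C.2.
Proof.
move=> MC lt1; have [_ sub _] := min_coversP _ _ MC.
have [V0 E0] := excess_factor_lt1 sub lt1 (min_cover_factor r MC).
rewrite subsetD (part_sub VV_cover) -setI_eq0 setIC V0 eqxx; split=> //.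
apply/subsetP=> e er; apply/negPn/negP=> eC; move/setP/(_ e): E0.
by rewrite !inE eC er (subsetP (part_sub EE_cover r)).
Qed.

(** The minimal cover with fewest vertices and most hyperedges; the intersections defining [Vplus]
    and [Eplus] are attained at it. *)
Lemma cover_gt1 : (\bigcup_(r < k | 1 < d r) VV r,
                   \bigcup_(r < k | ~~ (1 < d r)) EE r) \in min_covers H.
Proof.
apply: (@prefix_cover (fun r => 1 < d r)) => // [s t st gt1|r /ltW//].
exact: lt_le_trans gt1 (density_le st).
Qed.

(** The opposite extreme, with most vertices and fewest hyperedges, where [Vminus] and [Eminus] are
    attained. *)
Lemma cover_ge1 : (\bigcup_(r < k | 1 <= d r) VV r,
                   \bigcup_(r < k | ~~ (1 <= d r)) EE r) \in min_covers H.
Proof.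
apply: (@prefix_cover (fun r => 1 <= d r)) => // [s t st ge1|r /ltW//].
exact: le_trans ge1 (density_le st).
Qed.

(** * Identification of the Dulmage-Mendelsohn parts *)

Let lt1E (T : finType) (A : 'I_k -> {set T}) :
  \bigcup_(r < k | ~~ (1 <= d r)) A r = \bigcup_(r < k | d r < 1) A r.
Proof. by apply: eq_bigl => r; rewrite -ltNge. Qed.

Lemma Vplus_spectral : Vplus H = \bigcup_(r < k | 1 < d r) VV r.
Proof.
rewrite /Vplus (bigcap_attained cover_gt1) // => C MC /=.
by apply/bigcupsP=> r /(min_cover_gt1 MC)[].
Qed.

Lemma Vminus_spectral : Vminus H = \bigcup_(r < k | d r < 1) VV r.
Proof.
have rest := bigcup_part_complement VV_disjoint VV_cover (fun r => 1 <= d r).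
rewrite /Vminus (bigcap_attained cover_ge1) /= ?rest ?lt1E // => C MC.
by apply/bigcupsP=> r /(min_cover_lt1 MC)[].
Qed.

Lemma Eplus_spectral : Eplus H = \bigcup_(r < k | 1 < d r) EE r.
Proof.
have rest : eset H :\: \bigcup_(r < k | ~~ (1 < d r)) EE r =
    \bigcup_(r < k | 1 < d r) EE r.
  rewrite (bigcup_part_complement EE_disjoint EE_cover).
  by apply: eq_bigl => r; rewrite negbK.
rewrite /Eplus (bigcap_attained cover_gt1) /= ?rest // => C MC.
by apply/bigcupsP=> r /(min_cover_gt1 MC)[].
Qed.

Lemma Eminus_spectral : Eminus H = \bigcup_(r < k | d r < 1) EE r.
Proof.
rewrite /Eminus (bigcap_attained cover_ge1) /= ?lt1E // => C MC.
by apply/bigcupsP=> r /(min_cover_lt1 MC)[].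
Qed.

Let eq1E (T : finType) (A : 'I_k -> {set T}) :
  \bigcup_(r < k | ~~ ((1 < d r) || (d r < 1))) A r =
  factor_of_density VV EE A 1.
Proof.
rewrite (factor_of_densityE density_inj); apply: eq_bigl => r.
by rewrite orbC -neq_lt negbK.
Qed.

Lemma Vzero_spectral : Vzero H = factor_of_density VV EE VV 1.
Proof.
rewrite /Vzero Vplus_spectral Vminus_spectral.
by rewrite (bigcup_partU_complement VV_disjoint VV_cover) eq1E.
Qed.

Lemma Ezero_spectral : Ezero H = factor_of_density VV EE EE 1.
Proof.
rewrite /Ezero Eplus_spectral Eminus_spectral.
by rewrite (bigcup_partU_complement EE_disjoint EE_cover) eq1E.
Qed.

End Spectral.

Theorem theorem9 (V E : finType) (H : hypergraph V E)
    (vertex_covered : forall v, v \in vset H ->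
       exists2 e, e \in eset H & v \in supp H e)
    (supp_neq0 : forall e, e \in eset H -> supp H e != set0)
    (k : nat) (VV : 'I_k -> {set V}) (EE : 'I_k -> {set E})
    (spectral : spectral_decomposition H VV EE) :
  (Vplus H = \bigcup_(r < k | 1 < density (VV r) (EE r)) VV r /\
   Vzero H = factor_of_density VV EE VV 1 /\
   Vminus H = \bigcup_(r < k | density (VV r) (EE r) < 1) VV r) /\
  (Eplus H = \bigcup_(r < k | 1 < density (VV r) (EE r)) EE r /\
   Ezero H = factor_of_density VV EE EE 1 /\
   Eminus H = \bigcup_(r < k | density (VV r) (EE r) < 1) EE r).
Proof.
rewrite (Vplus_spectral supp_neq0 spectral) (Vzero_spectral supp_neq0 spectral).
rewrite (Vminus_spectral supp_neq0 spectral) (Eplus_spectral supp_neq0 spectral).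
by rewrite (Ezero_spectral supp_neq0 spectral) (Eminus_spectral supp_neq0 spectral).
Qed.
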